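(* Every isometric predual of $\ell_1$, i.e. every Banach space $X$ whose dual $X^*$ is isometrically isomorphic to $\ell_1$, has property $(\overline{\mathrm{P1}})$.
   Context: Banach spaces are real or complex. For a Banach space $X$, $B_X$ is the closed unit ball. For $f\in B_{X^*}$ and $\varepsilon>0$, the slice of $B_X$ is $S(B_X,f,\varepsilon)=\{x\in B_X:\ \mathrm{Re}\, f(x)>\sup_{c\in B_X}|f(c)|-\varepsilon\}$. A convex combination of slices of $B_X$ is a set $\sum_{i=1}^n\lambda_i S_i=\{\sum_{i=1}^n \lambda_i x_i: x_i\in S_i\}$ with $n\in\mathbb{N}$, $\lambda_i>0$, $\sum_{i=1}^n\lambda_i=1$ and each $S_i$ a slice of $B_X$. $X$ has property $(\overline{\mathrm{P1}})$ if for every convex combination of slices $C$ of $B_X$ and every $x\in C$ there exists a relatively weakly open subset $W$ of $B_X$ with $x\in W\subseteq\overline{C}$ (norm closure). *)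

(* Defs.v *)
From HB Require Import structures.
From mathcomp Require Import all_boot all_order all_algebra.
From mathcomp Require Import complex.
From mathcomp Require Import all_classical all_reals all_analysis.

Set Implicit Arguments.
Unset Strict Implicit.
Unset Printing Implicit Defensive.

Import Order.TTheory GRing.Theory Num.Theory.
Import numFieldNormedType.Exports.

Local Open Scope classical_set_scope.
Local Open Scope ring_scope.

(* A scalar field is given by a numFieldType K together with a real-part map
   re : K -> R. The intended instances are (K, re) = (R, id) and
   (K, re) = (R[i], complex.Re). Norms take their values in K, so that
   re `|x| is the norm of x as an element of R. *)

Section Dual.
Context {K : numFieldType} (X : normedModType K).

Definition dual_pred : {pred X -> K^o} :=
  fun f => `[< linear f /\ continuous f >].

Lemma dual_pred_submod_closed : submod_closed dual_pred.
Proof.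
split=> [|a u v /asboolP[ul uc] /asboolP[vl vc]]; apply/asboolP; split.
- by move=> a x y /=; rewrite scaler0 addr0.
- exact: cst_continuous.
- move=> b x y; rewrite !fctE ul vl !scalerDr !scalerA (mulrC b a).
  by rewrite -!addrA; congr (_ + _); rewrite addrCA.
- move=> x; apply: continuousD; last exact: vc.
  by apply: continuousZr; exact: uc.
Qed.

HB.instance Definition _ :=
  GRing.isSubmodClosed.Build K (X -> K^o) dual_pred dual_pred_submod_closed.

Record dual := Dual { dual_fun :> X -> K^o; _ : dual_fun \in dual_pred }.

HB.instance Definition _ := [isSub of dual for dual_fun].
HB.instance Definition _ := [Choice of dual by <:].
HB.instance Definition _ := [SubChoice_isSubLmodule of dual by <:].

Definition weak_topology : topologicalType :=
  sup_topology (fun f : dual =>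
    Topological.on (initial_topology (f : X -> K^o))).

Definition unit_ball : set X := [set x | `|x| <= 1].

End Dual.

Arguments unit_ball {K} X.

Section L1.
Context (K : numFieldType).

Definition l1_pred : {pred nat -> K^o} :=
  fun a => `[< exists M : K, forall n, \sum_(i < n) `|a i| <= M >].

Lemma l1_pred_submod_closed : submod_closed l1_pred.
Proof.
split=> [|c a b /asboolP[M aM] /asboolP[N bN]]; apply/asboolP.
  by exists 0 => n; rewrite big1// => i _; rewrite normr0.
exists (`|c| * M + N) => n.
apply: (@le_trans _ _ (`|c| * (\sum_(i < n) `|a i|) + \sum_(i < n) `|b i|)).
  rewrite mulr_sumr -big_split; apply: ler_sum => i _ /=.
  by rewrite (le_trans (ler_normD _ _))// lerD// normrM.
by apply: lerD => //; exact: ler_wpM2l.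
Qed.

HB.instance Definition _ :=
  GRing.isSubmodClosed.Build K (nat -> K^o) l1_pred l1_pred_submod_closed.

Record l1 := L1 { l1_seq :> nat -> K^o; _ : l1_seq \in l1_pred }.

HB.instance Definition _ := [isSub of l1 for l1_seq].
HB.instance Definition _ := [Choice of l1 by <:].
HB.instance Definition _ := [SubChoice_isSubLmodule of l1 by <:].

End L1.

Section P1.
Context {R : realType} {K : numFieldType} (re : K -> R).

Definition l1_norm (a : l1 K) : R := limn (series (fun n => re `|a n|)).

Context (X : normedModType K).

Definition dual_norm (f : dual X) : R :=
  sup [set re `|f c| | c in unit_ball X].

Definition isometric_predual_l1 : Prop :=
  exists T : {linear dual X -> l1 K},
    bijective T /\ forall f, l1_norm (T f) = dual_norm f.

Definition slice (f : dual X) (e : R) : set X :=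
  [set x | unit_ball X x /\ dual_norm f - e < re (f x)].

Definition is_slice (S : set X) : Prop :=
  exists (f : dual X) (e : R), [/\ dual_norm f <= 1, 0 < e & S = slice f e].

(* The weights are elements of K: the order of R[i] is such that 0 < z only
   holds for real z, so they are positive reals in both cases. *)
Definition is_convex_combination_of_slices (C : set X) : Prop :=
  exists (n : nat) (lambda : 'I_n -> K) (S : 'I_n -> set X),
    [/\ forall i, 0 < lambda i, \sum_i lambda i = 1,
        forall i, is_slice (S i)
      & C = [set x | exists y : 'I_n -> X,
               (forall i, S i (y i)) /\ x = \sum_i lambda i *: y i]].

Definition relatively_weakly_open (W : set X) : Prop :=
  exists U : set X, open (U : set (weak_topology X)) /\ W = U `&` unit_ball X.

Definition property_P1bar : Prop :=
  forall C, is_convex_combination_of_slices C -> forall x, C x ->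
    exists W, [/\ relatively_weakly_open W, W x & W `<=` closure C].

End P1.

(* Main.v *)
(* Write X^* = l1 with unit vector basis (e_i), so that X sits in l_infinity
   through x |-> (e_i x)_i. Let x = \sum_k lam_k x_k with x_k in the slice S_k,
   and let y in the unit ball be close to x in the first N coordinates. The
   scalar map (t_k) |-> \sum_k lam_k t_k is open on the disc, so the first N
   coordinates of y split as \sum_k lam_k s_k with s_k close to those of x_k.
   Let y_k in l_infinity have first coordinates s_k and the same further
   coordinates as y. Then y = \sum_k lam_k y_k, each y_k has norm at most 1, and
   for N large it lies in the bidual slice determined by S_k. A single
   application of the Mazur-Orlicz theorem on X * R^n then yields points of the
   S_k whose convex combination is as close to y in norm as desired; it replaces
   Goldstine's and Mazur's theorems. Each y_k differs from y in finitely many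
   coordinates only, so bidual elements need not be introduced: the value of h
   at y_k is h y plus a finite sum. *)

Require Import Defs.
From HB Require Import structures.
From mathcomp Require Import all_boot all_order all_algebra.
From mathcomp Require Import complex.
From mathcomp Require Import ring lra.
From mathcomp Require Import all_classical all_reals all_analysis.
Set Implicit Arguments.
Unset Strict Implicit.
Import Order.TTheory GRing.Theory Num.Theory.
Import numFieldNormedType.Exports.
Local Open Scope classical_set_scope.
Local Open Scope ring_scope.
Local Open Scope complex_scope.

(** * Sublinear functionals *)

Section Sublinear.
Context {R : realType} {V : lmodType R}.
Implicit Types (p q : V -> R) (D : set V).

Definition sublinear q :=
  (forall x y, q (x + y) <= q x + q y) /\
  (forall (t : R) x, 0 <= t -> q (t *: x) = t * q x).

Lemma sublinearP q : (forall x y, q (x + y) <= q x + q y) ->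
  (forall (t : R) x, 0 < t -> q (t *: x) <= t * q x) -> sublinear q.
Proof.
move=> qD qZ; split=> // t x; rewrite le_eqVlt => /orP[/eqP<-|t0].
  have := qD 0 0; have := qZ 2^-1 0; rewrite invr_gt0 ltr0n => /(_ isT).
  rewrite scale0r scaler0 addr0 mul0r; lra.
apply/eqP; rewrite eq_le qZ//=.
have := qZ t^-1 (t *: x); rewrite invr_gt0 scalerA mulVf ?gt_eqF// scale1r.
by move=> /(_ t0); rewrite ler_pdivlMl.
Qed.

Lemma sublinear_lb q x : sublinear q -> - q (- x) <= q x.
Proof.
move=> [qD qZ]; have := qD x (- x); rewrite subrr.
by have := qZ 0 0 (lexx _); rewrite scale0r mul0r => ->; lra.
Qed.

Definition convex_set D := forall (s t : R) d e,
  0 <= s -> 0 <= t -> s + t = 1 -> D d -> D e -> D (s *: d + t *: e).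

(* The largest sublinear q' <= q with q' (- d) <= - delta for all d in D. *)
Definition shrink q D (delta : R) (x : V) : R :=
  inf [set q (x + t.1 *: t.2) - t.1 * delta | t in [set t | 0 <= t.1 /\ D t.2]].

Section Shrink.
Context q D (delta : R).
Hypotheses (q_sub : sublinear q) (D0 : D !=set0) (D_conv : convex_set D)
  (D_ge : forall d, D d -> delta <= q d).

(** This bound makes the infimum in [shrink] a genuine one; on a set unbounded below, [inf] would
    only return a default value. *)
Let shrink_lb x (t : R) d : 0 <= t -> D d ->
  - q (- x) <= q (x + t *: d) - t * delta.
Proof.
move=> t0 Dd; have [qD qZ] := q_sub.
have := qD (x + t *: d) (- x); rewrite addrAC subrr add0r qZ//.
have := ler_wpM2l t0 (D_ge Dd); lra.
Qed.

Let shrink_le_at x (t : R) d : 0 <= t -> D d ->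
  shrink q D delta x <= q (x + t *: d) - t * delta.
Proof.
move=> t0 Dd; apply: ge_inf; last by exists (t, d).
by exists (- q (- x)) => _ [[s e] [/= s0 De] <-]; exact: shrink_lb.
Qed.

Let shrink_ge x (c : R) :
  (forall (t : R) d, 0 <= t -> D d -> c <= q (x + t *: d) - t * delta) ->
  c <= shrink q D delta x.
Proof.
move=> H; apply: lb_le_inf.
  by have [d Dd] := D0; eexists; exists (0, d); first by split.
by move=> _ [[t d] [/= t0 Dd] <-]; exact: H.
Qed.

Lemma shrink_le x : shrink q D delta x <= q x.
Proof.
have [d Dd] := D0; have := @shrink_le_at x 0 d (lexx _) Dd.
by rewrite scale0r addr0 mul0r subr0.
Qed.

Lemma shrinkN d : D d -> shrink q D delta (- d) <= - delta.
Proof.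
move=> Dd; have := @shrink_le_at (- d) 1 d ler01 Dd.
rewrite scale1r addNr mul1r; have [_ /(_ 0 0 (lexx _))] := q_sub.
by rewrite scale0r mul0r => ->; rewrite sub0r.
Qed.

Lemma sublinear_shrink : sublinear (shrink q D delta).
Proof.
have [qD qZ] := q_sub.
apply: sublinearP => [x y|r x r0].
  rewrite -lerBlDr; apply: shrink_ge => s d s0 Dd.
  rewrite lerBlDr -lerBlDl; apply: shrink_ge => t e t0 De.
  have [st0|st0] := eqVneq (s + t) 0.
    have /eqP s00 : s == 0 by apply/eqP; lra.
    have /eqP t00 : t == 0 by apply/eqP; lra.
    rewrite s00 t00 !scale0r !addr0 !mul0r.
    by have := shrink_le (x + y); have := qD x y; lra.
  have stgt0 : 0 < s + t by rewrite lt_neqAle eq_sym st0 addr_ge0.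
  (* Convexity enters here: [s *: d + t *: e] is [s + t] times a point of [D]. The case [s + t = 0]
     was split off because of the division. *)
  have : D ((s / (s + t)) *: d + (t / (s + t)) *: e).
    apply: D_conv => //; first by rewrite divr_ge0// ltW.
      by rewrite divr_ge0// ltW.
    by rewrite -mulrDl divff.
  move=> /(@shrink_le_at (x + y) _ _ (ltW stgt0)).
  rewrite scalerDr !scalerA !(mulrCA (s + t)) divff// !mulr1 addrACA.
  have := qD (x + s *: d) (y + t *: e); lra.
rewrite -ler_pdivrMl//; apply: shrink_ge => t d t0 Dd.
rewrite ler_pdivrMl//.
apply: (le_trans (shrink_le_at _ (mulr_ge0 (ltW r0) t0) Dd)).
by rewrite -scalerA -scalerDr (qZ _ _ (ltW r0)) mulrBr mulrA.
Qed.

End Shrink.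

(** Shrinking along the single point [y] with [delta = q y] cannot lower a minimal [q]; the
    parameter 1 in the infimum then gives [q x <= q (x + y) - q y]. *)
Lemma minimal_sublinear_additive q : sublinear q ->
  (forall q', sublinear q' -> (forall x, q' x <= q x) ->
     forall x, q x <= q' x) ->
  forall x y, q (x + y) = q x + q y.
Proof.
move=> q_sub q_min x y; apply/eqP; rewrite eq_le (q_sub.1 x y)/=.
have D0 : [set y] !=set0 by exists y.
have Dc : convex_set [set y].
  by move=> s t d e _ _ st /= -> ->; rewrite -scalerDl st scale1r.
have Dge d : [set y] d -> q y <= q d by move=> ->.
have /q_min : sublinear (shrink q [set y] (q y)) by exact: sublinear_shrink.
move=> /(_ (shrink_le q_sub D0 Dge) x) H.
rewrite -lerBrDr; apply: (le_trans H); apply: ge_inf.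
  exists (- q (- x)) => _ [[s e] [/= s0 ->] <-].
  have := q_sub.1 (x + s *: y) (- x); rewrite addrAC subrr add0r q_sub.2//; lra.
by exists (1, y); rewrite /= ?ler01 ?scale1r ?mul1r.
Qed.

(* Zorn's lemma on the pointwise order: a minimal sublinear functional below q
   is linear. *)
Lemma sublinear_minorant q : sublinear q ->
  exists u : {linear V -> R^o}, forall x, u x <= q x.
Proof.
move=> q_sub.
pose T := {p : V -> R | sublinear p /\ forall x, p x <= q x}.
(* The order is reversed, so that the maximal element given by Zorn's lemma is a minimal
   functional. *)
pose le_T (p p' : T) := `[< forall x, sval p' x <= sval p x >].
have q0 : T by exists q.
have [|p1 p2 p3 /asboolP p12 /asboolP p23|A A_tot|[p [p_sub pq]] p_min] :=
    @ZL_preorder T q0 le_T.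
- by move=> p; apply/asboolP.
- by apply/asboolP => x; exact: le_trans (p23 x) (p12 x).
- have [[p0 Ap0]|A0] := pselect (A !=set0); last first.
    by exists q0 => p Ap; absurd: A0; exists p.
  (* A nonempty chain is bounded by its pointwise infimum. *)
  pose m x := inf [set sval p x | p in A].
  have lb x : has_lbound [set sval p x | p in A].
    exists (- q (- x)) => _ [p Ap <-]; have [p_sub pq] := svalP p.
    by have := sublinear_lb x p_sub; have := pq (- x); lra.
  have m_le (p : T) x : A p -> m x <= sval p x.
    by move=> Ap; apply: ge_inf => //; exists p.
  have m_ge x (c : R) : (forall p : T, A p -> c <= sval p x) -> c <= m x.
    move=> H; apply: lb_le_inf; first by exists (sval p0 x), p0.
    by move=> _ [p Ap <-]; exact: H.
  have m_sub : sublinear m.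
    apply: sublinearP => [x y|t x t0].
      rewrite -lerBlDr; apply: (m_ge) => p Ap.
      rewrite lerBlDr -lerBlDl; apply: (m_ge) => p' Ap'; rewrite lerBlDr.
      (* The smaller of [p] and [p'] serves at both [x] and [y]; this is where the chain property is
         used. *)
      have [/asboolP pp'|/asboolP pp'] := A_tot _ _ Ap Ap'.
        apply: (le_trans (m_le _ (x + y) Ap')).
        by apply: (le_trans ((svalP p').1.1 x y)); rewrite addrC lerD2l.
      apply: (le_trans (m_le _ (x + y) Ap)).
      by apply: (le_trans ((svalP p).1.1 x y)); rewrite addrC lerD2r.
    rewrite -ler_pdivrMl//; apply: (m_ge) => p Ap.
    rewrite ler_pdivrMl// -((svalP p).1.2 t x (ltW t0)).
    exact: m_le.
  have mq x : m x <= q x.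
    by apply: (le_trans (m_le _ x Ap0)); exact: (svalP p0).2.
  exists (exist _ m (conj m_sub mq)) => p Ap; apply/asboolP => x /=.
  exact: m_le.
have pD : forall x y, p (x + y) = p x + p y.
  apply: minimal_sublinear_additive => // p' p'_sub p'p x.
  have p'q y : p' y <= q y := le_trans (p'p y) (pq y).
  have := p_min (exist _ p' (conj p'_sub p'q)); rewrite /le_T /=.
  by move=> H; move: (H (asboolT p'p)) => /asboolP; exact.
have pN x : p (- x) = - p x.
  apply/eqP; rewrite -addr_eq0 -pD addNr; apply/eqP.
  by have := p_sub.2 0 0 (lexx _); rewrite scale0r mul0r.
have p_lin : linear (p : V -> R^o).
  move=> a x y; rewrite pD; congr (_ + _).
  have [a0|a0] := leP 0 a; first exact: p_sub.2.
  by rewrite -[a *: x]opprK pN -scaleNr p_sub.2 ?oppr_ge0 1?ltW// mulNr opprK.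
pose L := GRing.isLinear.Build R V R^o *:%R p p_lin.
pose u : {linear V -> R^o} := HB.pack p L.
by exists u.
Qed.

(** Any linear [u] below [shrink q D delta] works: it is at most [- delta] at [- d], and linearity
    flips the sign. *)
Lemma mazur_orlicz q D (delta : R) : sublinear q -> D !=set0 ->
  convex_set D -> (forall d, D d -> delta <= q d) ->
  exists2 u : {linear V -> R^o}, (forall x, u x <= q x) &
    (forall d, D d -> delta <= u d).
Proof.
move=> q_sub D0 Dc Dge.
have [u uq] := sublinear_minorant (sublinear_shrink q_sub D0 Dc Dge).
exists u => [x|d Dd]; first exact: le_trans (uq x) (shrink_le q_sub D0 Dge x).
have := le_trans (uq (- d)) (shrinkN q_sub Dge Dd).
by rewrite linearN lerN2.
Qed.

End Sublinear.

(** * Real and complex scalars *)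

(* The real vector space underlying V, for iota the inclusion of R in K. *)
Definition realified (R : realType) (K : numFieldType)
  (iota : {rmorphism R -> K}) (V : lmodType K) : Type := V.

Section Realified.
Context (R : realType) (K : numFieldType) (iota : {rmorphism R -> K})
  (V : lmodType K).
Local Notation W := (realified iota V).

HB.instance Definition _ := GRing.Zmodule.on W.

Let scale (a : R) (x : W) : W := iota a *: (x : V).

Let scaleA a b x : scale a (scale b x) = scale (a * b) x.
Proof. by rewrite /scale scalerA rmorphM. Qed.

Let scale1 : left_id 1 scale.
Proof. by move=> x; rewrite /scale rmorph1 scale1r. Qed.

Let scaleDr : right_distributive scale +%R.
Proof. by move=> a x y; rewrite /scale scalerDr. Qed.

Let scaleDl x : {morph scale^~ x : a b / a + b}.
Proof. by move=> a b; rewrite /scale rmorphD scalerDl. Qed.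

HB.instance Definition _ :=
  GRing.Zmodule_isLmodule.Build R W scaleA scale1 scaleDr scaleDl.

Lemma realified_scaleE (a : R) (x : V) : a *: (x : W) = iota a *: x.
Proof. by []. Qed.

End Realified.

(* What the proof uses of the pairs (R, id) and (R[i], Re). *)
Record real_part (R : realType) (K : numFieldType) (re : K -> R)
    (iota : {rmorphism R -> K}) : Prop := RealPart {
  re_add : {morph re : z w / z + w};
  re_iotaM : forall (a : R) (z : K), re (iota a * z) = a * re z;
  re_one : re 1 = 1;
  norm_iota : forall z : K, `|z| = iota (re `|z|);
  re_le_norm : forall z : K, re z <= re `|z|;
  iota_ge0 : forall a, 0 <= a -> 0 <= iota a;
  re_eq1 : forall z : K, `|z| <= 1 -> re z = 1 -> z = 1;
  real_linear_lift : forall (V : lmodType K)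
    (u : {linear realified iota V -> R^o}),
    exists f : {linear V -> K^o}, forall x, re (f x) = u x }.

Section RealPart.
Context (R : realType) (K : numFieldType) (re : K -> R)
  (iota : {rmorphism R -> K}) (rp : real_part re iota).

Lemma re_iota a : re (iota a) = a.
Proof. by rewrite -[iota a]mulr1 (re_iotaM rp) (re_one rp) mulr1. Qed.

Lemma re0 : re 0 = 0.
Proof. by rewrite -(rmorph0 iota) re_iota. Qed.

Lemma reN z : re (- z) = - re z.
Proof. by apply/eqP; rewrite -addr_eq0 -(re_add rp) addNr re0. Qed.

Lemma reB z w : re (z - w) = re z - re w.
Proof. by rewrite (re_add rp) reN. Qed.

Lemma re_sum I (r : seq I) (P : pred I) (F : I -> K) :
  re (\sum_(i <- r | P i) F i) = \sum_(i <- r | P i) re (F i).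
Proof. exact: (big_morph _ (re_add rp) re0). Qed.

Lemma ge0_iota z : 0 <= z -> z = iota (re z).
Proof. by move=> z0; rewrite -{2}(ger0_norm z0) -(norm_iota rp) ger0_norm. Qed.

Lemma re_ge0 z : 0 <= z -> 0 <= re z.
Proof.
move=> z0; have := re_le_norm rp (- z); rewrite normrN (ger0_norm z0) reN; lra.
Qed.

Lemma le_re z w : z <= w -> re z <= re w.
Proof. by rewrite -subr_ge0 => /re_ge0; rewrite reB subr_ge0. Qed.

Lemma le_iota a b : (iota a <= iota b) = (a <= b).
Proof.
apply/idP/idP => [/le_re|]; first by rewrite !re_iota.
by rewrite -subr_ge0 => /(iota_ge0 rp); rewrite rmorphB subr_ge0.
Qed.

Lemma lt_iota a b : (iota a < iota b) = (a < b).
Proof.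
by rewrite !lt_neqAle le_iota (inj_eq (can_inj re_iota)).
Qed.

Lemma ge0_le_re z w : 0 <= z -> 0 <= w -> (re z <= re w) = (z <= w).
Proof. by move=> /ge0_iota {2}-> /ge0_iota {2}->; rewrite le_iota. Qed.

Section NormedModule.
Context (X : normedModType K).

Lemma mod_norm_iota (x : X) : `|x| = iota (re `|x|).
Proof. exact: ge0_iota. Qed.

Lemma re_norm_ge0 (x : X) : 0 <= re `|x|.
Proof. exact: re_ge0. Qed.

Lemma re_normD (x y : X) : re `|x + y| <= re `|x| + re `|y|.
Proof. by rewrite -(re_add rp) le_re// ler_normD. Qed.

Lemma re_normZ (z : K) (x : X) : re `|z *: x| = re `|z| * re `|x|.
Proof. by rewrite normrZ (norm_iota rp z) (re_iotaM rp) re_iota. Qed.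

Lemma re_norm_iota a : 0 <= a -> re `|iota a| = a.
Proof. by move=> a0; rewrite ger0_norm ?re_iota ?(iota_ge0 rp). Qed.

Lemma unit_ballP (x : X) : unit_ball X x <-> re `|x| <= 1.
Proof.
by rewrite /unit_ball/= -(re_one rp) ge0_le_re.
Qed.

Lemma unit_ball_convex (s t : R) (x y : X) : 0 <= s -> 0 <= t -> s + t = 1 ->
  unit_ball X x -> unit_ball X y -> unit_ball X (iota s *: x + iota t *: y).
Proof.
move=> s0 t0 st /unit_ballP x1 /unit_ballP y1; apply/unit_ballP.
apply: (le_trans (re_normD _ _)); rewrite !re_normZ !re_norm_iota//.
have := ler_wpM2l s0 x1; have := ler_wpM2l t0 y1; lra.
Qed.

Lemma dual_linear (f : dual X) : linear (f : X -> K^o).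
Proof. by case: f => f /= /asboolP[]. Qed.

HB.instance Definition _ (f : dual X) :=
  GRing.isLinear.Build K X K^o *:%R f (dual_linear f).

Lemma dual_continuous (f : dual X) : continuous (f : X -> K^o).
Proof. by case: f => f /= /asboolP[]. Qed.

Lemma dual_norm_has_sup (f : dual X) :
  has_sup [set re `|f c| | c in unit_ball X].
Proof.
split; first by exists (re `|f 0|), 0; rewrite // /unit_ball /= normr0.
have /linear_bounded_continuous/bounded_funP/(_ 1)[M fM] := @dual_continuous f.
by exists (re M) => _ [c c1 <-]; apply: le_re; exact: fM.
Qed.

Lemma dual_norm_ub (f : dual X) c : unit_ball X c ->
  re `|f c| <= dual_norm re f.
Proof.
move=> c1; apply: sup_upper_bound; first exact: dual_norm_has_sup.
by exists c.
Qed.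

Lemma unimodular_rotation (z : K) : exists2 w : K, `|w| = 1 & w * z = `|z|.
Proof.
have [->|z0] := eqVneq z 0; first by exists 1; rewrite ?normr1// normr0 mulr0.
by exists (`|z| / z); rewrite ?divfK// normrM normfV normr_id divff ?normr_eq0.
Qed.

(** Rotating a nearly norming [c] by a unimodular scalar makes [f c] real and nonnegative, so real
    parts approach the same supremum as moduli. *)
Lemma dual_norm_adherent (f : dual X) e : 0 < e ->
  exists2 c, unit_ball X c & dual_norm re f - e < re (f c).
Proof.
move=> e0; have [_ [c c1 <-] cf] := sup_adherent e0 (dual_norm_has_sup f).
have [w w1 wf] := unimodular_rotation (f c).
exists (w *: c); first by rewrite /unit_ball/= normrZ w1 mul1r.
by rewrite linearZ/= -[_ *: _]/(w * f c) wf.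
Qed.

(** The lift [f] is continuous because a rotation of [x] turns the modulus of [f x] into a value of
    [u], which the norm of [x] bounds. *)
Lemma dual_of_real_linear (u : {linear realified iota X -> R^o}) :
  (forall x : X, u x <= re `|x|) -> exists f : dual X, forall x, re (f x) = u x.
Proof.
move=> ux; have [f fu] := real_linear_lift rp u.
have f_le x : `|f x| <= 1 * `|x|.
  rewrite mul1r -ge0_le_re//; have [w w1 wf] := unimodular_rotation (f x).
  rewrite -wf -[w * f x]/(w *: (f x : K^o)) -linearZ fu.
  by rewrite (le_trans (ux _))// normrZ w1 mul1r.
have fc : continuous f.
  apply/linear_bounded_continuous/linear_boundedP.
  apply: filterS (nbhs_pinfty_ge (real1 K)) => r r1 x.
  by apply: (le_trans (f_le x)); rewrite ler_wpM2r.
have fP : (f : X -> K^o) \in @dual_pred K X.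
  by apply/asboolP; split => //; exact: linearP.
by exists (Dual fP).
Qed.

End NormedModule.
End RealPart.

(** * Truncation of summable sequences *)

Section L1.
Context (R : realType) (K : numFieldType) (re : K -> R)
  (iota : {rmorphism R -> K}) (rp : real_part re iota).
Implicit Types a b : l1 K.

Definition l1_head a N : R := \sum_(i < N) re `|a i|.

Lemma l1_headE a N : l1_head a N = series (fun n => re `|a n|) N.
Proof. by rewrite /series/= big_mkord. Qed.

Lemma l1_head_nondecreasing a : nondecreasing_seq (l1_head a).
Proof.
apply/nondecreasing_seqP => n; rewrite /l1_head big_ord_recr/= lerDl.
exact: (re_norm_ge0 rp).
Qed.

Lemma l1_head_cvg a : l1_head a @ \oo --> l1_norm re a.
Proof.
have <- : series (fun n => re `|a n|) = l1_head a.
  by apply/funext => N; rewrite l1_headE.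
apply: nondecreasing_is_cvgn.
  by move=> m n mn; rewrite -!l1_headE l1_head_nondecreasing.
case: a => a /= /asboolP[M aM]; exists (re M) => _ [n _ <-].
by rewrite /series/= big_mkord -(re_sum rp) (le_re rp).
Qed.

Lemma l1_head_le a N : l1_head a N <= l1_norm re a.
Proof.
rewrite -(cvg_lim (@Rhausdorff R) (@l1_head_cvg a)).
apply: nondecreasing_cvgn_le; first exact: l1_head_nondecreasing.
by apply/cvg_ex; exists (l1_norm re a); exact: l1_head_cvg.
Qed.

Lemma l1_tail_small a (e : R) : 0 < e ->
  \forall N \near \oo, l1_norm re a - l1_head a N < e.
Proof.
move=> e0; have := l1_head_cvg (a := a) => /cvgrPdist_lt /(_ _ e0).
by apply: filterS => N /(le_lt_trans (ler_norm _)).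
Qed.

(** From index [N] on, the partial sums of [b] are those of [a] minus the constant [l1_head a N];
    the limits differ by the same constant. *)
Lemma l1_norm_tail a b N : (forall i, b i = if (i < N)%N then 0 else a i) ->
  l1_norm re b = l1_norm re a - l1_head a N.
Proof.
move=> bE; apply: (cvg_unique (@Rhausdorff R) (@l1_head_cvg b)) => /=.
have H : (l1_head a M - l1_head a N) @[M --> \oo] -->
    l1_norm re a - l1_head a N.
  by apply: cvgB; [exact: l1_head_cvg | exact: cvg_cst].
apply: cvg_trans H; apply: near_eq_cvg; exists N => // M /= NM.
rewrite /l1_head -!(big_mkord xpredT (fun i => re `|_ i|)).
rewrite !(@big_cat_nat _ _ _ N 0 M)//= addrAC subrr add0r.
rewrite [X in _ = X + _]big_nat_cond [X in _ = X + _]big1 ?add0r; last first.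
  by move=> i /andP[/andP[_ iN] _]; rewrite bE iN normr0 (re0 rp).
by apply: eq_big_nat => i /andP[Ni _]; rewrite bE ltnNge Ni.
Qed.

Lemma sum_norm_delta j n :
  \sum_(i < n) `|((i : nat) == j)%:R : K| = (j < n)%:R.
Proof.
elim: n => [|n IHn]; first by rewrite big_ord0 ltn0.
rewrite big_ord_recr/= IHn ltnS [in RHS]leq_eqVlt (eq_sym j).
have [->|_] := eqVneq n j; first by rewrite ltnn add0r normr1.
by rewrite normr0 addr0.
Qed.

Lemma l1_delta_subproof j : (fun i => (i == j)%:R : K^o) \in @l1_pred K.
Proof.
by apply/asboolP; exists 1 => n; rewrite sum_norm_delta lern1 leq_b1.
Qed.

Definition l1_delta j : l1 K := L1 (l1_delta_subproof j).

Lemma l1_norm_delta_le1 j : l1_norm re (l1_delta j) <= 1.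
Proof.
rewrite -(cvg_lim (@Rhausdorff R) (@l1_head_cvg _)).
apply: limr_le; first by apply/cvg_ex; eexists; exact: l1_head_cvg.
apply: nearW => n; rewrite /l1_head -(re_sum rp) sum_norm_delta.
by rewrite -(re_one rp) (le_re rp)// lern1 leq_b1.
Qed.

End L1.

(** * Approximate solutions and openness *)

Section Combination.
Context (R : realType) (K : numFieldType) (re : K -> R)
  (iota : {rmorphism R -> K}) (rp : real_part re iota) (X : normedModType K).

(* A Helly-type criterion: in the intended use c k is the value of f k at bidual
   elements y_k of norm at most 1 with y = \sum_k lam k *: y_k, and the premise
   is \sum_k Re h_k(y_k) <= \sum_k |h_k| for h_k = lam k *: g + a k *: f k. *)
Lemma convex_combination_approx n (lam : 'I_n -> K) (f : 'I_n -> dual X)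
    (c : 'I_n -> R) (y : X) (delta : R) : 0 < delta ->
  (forall (g : dual X) (a : 'I_n -> R), (forall k, 0 <= a k) ->
    re (g y) + \sum_k a k * c k <=
      \sum_k dual_norm re (lam k *: g + iota (a k) *: f k)) ->
  exists z : 'I_n -> X, [/\ forall k, unit_ball X (z k),
    re `|y - \sum_k lam k *: z k| < delta &
    forall k, c k - delta < re (f k (z k))].
Proof.
move=> d0 H; apply: contrapT => noz.
pose V := (realified iota X * ('I_n -> R^o))%type.
(* The first component records the error in approximating [y], the second the shortfalls of the
   [f k] below [c k]; only positive shortfalls are penalised. *)
pose q (p : V) : R := re `|p.1 : X| + \sum_k Num.max (p.2 k : R) 0.
have max0_ge (r : R) : 0 <= Num.max r 0 by rewrite le_max lexx orbT.
have q_sub : sublinear q.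
  apply: sublinearP => [p p'|t p t0]; rewrite /q /=.
    rewrite addrACA -big_split/= lerD//; first exact: (re_normD rp).
    apply: ler_sum => k _; rewrite ge_max addr_ge0// andbT.
    by rewrite lerD// le_max lexx.
  rewrite realified_scaleE (re_normZ rp) (re_norm_iota rp (ltW t0)).
  rewrite mulrDr lerD2l mulr_sumr; apply: ler_sum => k _.
  rewrite ge_max mulr_ge0 ?(ltW t0)// andbT.
  by apply: ler_wpM2l; rewrite ?(ltW t0)// le_max lexx.
pose point (z : 'I_n -> X) : V :=
  (y - \sum_k lam k *: z k, fun k => c k - re (f k (z k))).
pose D := [set point z | z in [set z | forall k, unit_ball X (z k)]].
have D0 : D !=set0.
  by exists (point (fun=> 0)), (fun=> 0) => // k; rewrite /unit_ball/= normr0.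
have Dc : convex_set D.
  move=> s t _ _ s0 t0 st [z zB <-] [w wB <-].
  exists (fun k => iota s *: z k + iota t *: w k) => [k|].
    exact: (unit_ball_convex rp).
  congr pair.
    rewrite /point/= !realified_scaleE !scalerBr addrACA -scalerDl st scale1r.
    rewrite -opprD; congr (_ - _); rewrite !scaler_sumr -big_split/=.
    by apply: eq_bigr => k _; rewrite scalerDr !scalerA !(mulrC (lam k)).
  apply/funext => k.
  rewrite -[RHS]/(s * (c k - re (f k (z k))) + t * (c k - re (f k (w k)))).
  rewrite linearD !linearZ/= (re_add rp) !(re_iotaM rp).
  have -> : t = 1 - s by lra.
  ring.
(* A point of [D] with [q] below [delta] would come from a solution [z], against [noz]. *)
have Dge p : D p -> delta <= q p.
  move=> [z zB <-]; rewrite leNgt; apply/negP => qlt; apply: noz; exists z.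
  have sum_ge0 : 0 <= \sum_k Num.max (c k - re (f k (z k))) 0.
    by apply: sumr_ge0 => k _.
  move: qlt; rewrite /q/= => qlt; split => // [|k].
    by apply: le_lt_trans qlt; rewrite lerDl.
  rewrite ltrBlDr -ltrBlDl; apply: le_lt_trans qlt.
  apply: (@le_trans _ _ (\sum_k Num.max (c k - re (f k (z k))) 0)); last first.
    by rewrite lerDr (re_norm_ge0 rp).
  rewrite (bigD1 k)//= -[leLHS]addr0 lerD ?le_max ?lexx//.
  exact: sumr_ge0.
have [u uq uD] := mazur_orlicz q_sub D0 Dc Dge.
pose basis k : V := (0, fun j => (j == k)%:R).
pose a k := u (basis k).
have u1_lin : linear (fun x : realified iota X => u (x, 0)).
  move=> t x x'; rewrite -linearP; congr (u _); congr pair.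
  by rewrite /= scaler0 addr0.
pose L := GRing.isLinear.Build R (realified iota X) R^o *:%R _ u1_lin.
pose u1 : {linear realified iota X -> R^o} :=
  HB.pack (fun x : realified iota X => u (x, 0)) L.
have u1_le (x : X) : u1 x <= re `|x|.
  apply: (le_trans (uq _)); rewrite /q/= big1 ?addr0// => k _.
  by rewrite maxxx.
have [g gE] := dual_of_real_linear rp u1_le.
(* [q] vanishes at [- basis k], since a negative shortfall costs nothing. *)
have a_ge0 k : 0 <= a k.
  rewrite -oppr_le0 /a -linearN; apply: (le_trans (uq _)).
  rewrite /q/= oppr0 normr0 (re0 rp) add0r big1// => j _.
  by apply/max_idPr; rewrite oppr_le0 ler0n.
have uE (x : X) (r : 'I_n -> R^o) : u (x, r) = re (g x) + \sum_k r k * a k.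
  rewrite gE /u1/=.
  have -> : (x, r) = (x, 0) + \sum_k r k *: basis k :> V.
    rewrite [RHS]surjective_pairing; congr pair => /=.
      rewrite (big_morph (fun p : V => p.1) (id1 := 0) (op1 := +%R))//.
      by rewrite big1 ?addr0// => k _; rewrite /= scaler0.
    apply/funext => j.
    rewrite (big_morph (fun p : V => p.2) (id1 := 0) (op1 := +%R))//.
    rewrite add0r fct_sumE (bigD1 j)//= big1 ?addr0 => [|k kj].
      by rewrite -[RHS]/(r j * (j == j)%:R) eqxx mulr1.
    by rewrite -[LHS]/(r k * (j == k)%:R) eq_sym (negPf kj) mulr0.
  rewrite linearD linear_sum/=; congr (_ + _).
  by apply: eq_bigr => k _; rewrite linearZ.
pose h k : dual X := lam k *: g + iota (a k) *: f k.
have hE k x : h k x = lam k * g x + iota (a k) * f k x by [].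
(* The [n] errors add up to at most [delta / 2]; the successor keeps the divisor nonzero. *)
pose e := delta / 2 / n.+1%:R.
have e0 : 0 < e by rewrite !divr_gt0.
have /choice[z zP] k : exists c, unit_ball X c /\
    dual_norm re (h k) - e < re (h k c).
  by have [w wB wh] := dual_norm_adherent rp (h k) e0; exists w.
have Dz : D (point z) by exists z => // k; exact: (zP k).1.
(* At the nearly norming [z], the premise [H] bounds [u (point z)] by [delta / 2], whereas [uD]
   bounds it below by [delta]. *)
have := uD _ Dz; rewrite uE linearB/= linear_sum/= (reB rp) (re_sum rp).
have := H g a a_ge0.
have : \sum_k dual_norm re (h k) <= \sum_k re (h k (z k)) + delta / 2.
  apply: (@le_trans _ _ (\sum_k (re (h k (z k)) + e))).
    by apply: ler_sum => k _; have := (zP k).2; lra.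
  rewrite big_split/= lerD2l sumr_const card_ord -[leLHS]mulr_natr /e.
  by rewrite -mulrA ger_pMr ?divr_gt0// mulrC ler_pdivrMr// mul1r ler_nat.
have -> : \sum_k re (h k (z k)) =
    \sum_k re (g (lam k *: z k)) + \sum_k a k * re (f k (z k)).
  rewrite -big_split; apply: eq_bigr => k _.
  by rewrite hE (re_add rp) (re_iotaM rp) linearZ.
have -> : \sum_k (c k - re (f k (z k))) * a k =
    \sum_k a k * c k - \sum_k a k * re (f k (z k)).
  by rewrite -sumrB; apply: eq_bigr => k _; ring.
by rewrite -/(h _); lra.
Qed.

(* If the combination m of the t k has modulus 1, then all t k equal m by strict
   convexity and s' is constant; otherwise shrink the t k towards a common point
   v of the disc, chosen so that the combination becomes s. *)
Lemma disc_combination_open n (lam t : 'I_n -> K) (theta : K) :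
  (forall k, 0 < lam k) -> \sum_k lam k = 1 -> (forall k, `|t k| <= 1) ->
  0 < theta -> exists2 delta, 0 < delta &
    forall s, `|s| <= 1 -> `|s - \sum_k lam k * t k| < delta ->
    exists s' : 'I_n -> K, [/\ forall k, `|s' k| <= 1,
      forall k, `|s' k - t k| <= theta & \sum_k lam k * s' k = s].
Proof.
move=> lam0 lam1 t1 th0; set m := \sum_k lam k * t k.
have lam_sum (x : K) : \sum_k lam k * x = x by rewrite -mulr_suml lam1 mul1r.
have m1 : `|m| <= 1.
  apply: (le_trans (ler_norm_sum _ _ _)); rewrite -lam1; apply: ler_sum => k _.
  by rewrite normrM gtr0_norm// ler_piMr// ltW.
move: m1; rewrite le_eqVlt => /orP[/eqP m1|m1].
  exists theta => // s s1 sm; exists (fun=> s); split => // k.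
  suff -> : t k = m by exact: ltW.
  have m0 : m != 0 by rewrite -normr_eq0 m1 oner_eq0.
  have w1 j : `|t j / m| <= 1 by rewrite normrM normfV m1 invr1 mulr1.
  have rew j : re (t j / m) <= 1.
    rewrite (le_trans (re_le_norm rp _))// -[leRHS](re_one rp).
    exact: (le_re rp).
  have relam j : 0 < re (lam j).
    by rewrite -(lt_iota rp) rmorph0 -(ge0_iota rp)// ltW.
  (* The terms are nonnegative because [t j / m] lies in the disc. So each vanishes, and [re_eq1]
     gives [t j = m]. *)
  have : \sum_j re (lam j) * (1 - re (t j / m)) == 0.
    have -> : \sum_j re (lam j) * (1 - re (t j / m)) =
        re (\sum_j (lam j - lam j * t j / m)).
      rewrite (re_sum rp); apply: eq_bigr => j _.
      rewrite (reB rp) -mulrA {3}(ge0_iota rp (ltW (lam0 j))) (re_iotaM rp).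
      by rewrite mulrBr mulr1.
    by rewrite sumrB lam1 -mulr_suml divff// subrr (re0 rp).
  rewrite psumr_eq0 => [|j _]; last first.
    by rewrite mulr_ge0 ?subr_ge0 ?(ltW (relam j)).
  move=> /allP/(_ k (mem_index_enum _)); rewrite /= mulf_eq0 gt_eqF//=.
  rewrite subr_eq0 => /eqP/esym/(re_eq1 rp (w1 k)) tm.
  by rewrite -[LHS](divfK m0) tm mul1r.
(* Points of the disc are at distance at most 2, so moving a proportion [al] of the way towards [v]
   displaces [t k] by at most [theta]. *)
have [al [al0 al1 al2]] : exists al : K, [/\ 0 < al, al < 1 & al * 2 <= theta].
  have th2 : 0 < 2 + theta by rewrite addr_gt0.
  exists (theta / (2 + theta)); split; first by rewrite divr_gt0.
    by rewrite ltr_pdivrMr// mul1r ltrDr.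
  by rewrite mulrAC ler_pdivrMr// ler_wpM2l ?(ltW th0)// lerDl (ltW th0).
exists (al * (1 - `|m|)); first by rewrite mulr_gt0// subr_gt0.
(* [v] solves [(1 - al) * m + al * v = s], and the radius [al * (1 - |m|)] keeps it in the disc. *)
move=> s s1 sm; pose v := m + (s - m) / al.
have v1 : `|v| <= 1.
  apply: (le_trans (ler_normD _ _)); rewrite -lerBrDl normrM normfV.
  by rewrite (gtr0_norm al0) ler_pdivrMr// mulrC ltW.
exists (fun k => (1 - al) * t k + al * v); split => [k|k|].
- apply: (le_trans (ler_normD _ _)); rewrite !normrM (gtr0_norm al0).
  rewrite gtr0_norm ?subr_gt0//.
  rewrite [leRHS](_ : _ = (1 - al) * 1 + al * 1); last by ring.
  apply: lerD; apply: ler_wpM2l => //; last exact: ltW.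
  by rewrite subr_ge0 ltW.
- have -> : (1 - al) * t k + al * v - t k = al * (v - t k) by ring.
  apply: le_trans al2; rewrite normrM (gtr0_norm al0).
  apply: ler_wpM2l; first exact: ltW.
  by rewrite (le_trans (ler_normB _ _))// -[leRHS]/(1 + 1) lerD.
- under eq_bigr do rewrite mulrDr mulrCA.
  rewrite big_split/= -mulr_sumr -/m lam_sum /v mulrDr mulrCA divff ?gt_eqF//.
  ring.
Qed.

(** * Weak continuity of functionals and basic weak neighbourhoods *)

Lemma weak_continuous (f : dual X) :
  continuous (f : weak_topology X -> K^o).
Proof.
move=> x.
have [/(_ cvg_id f) xf _] := @cvg_sup _ _ (fun f : dual X =>
  Topological.on (initial_topology (f : X -> K^o))) (nbhs x) x _.
exact: cvg_comp xf (@initial_continuous _ _ (f : X -> K^o) x).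
Qed.

Lemma weak_nbhd (e : nat -> dual X) (x : X) (delta : nat -> K) N :
  (forall i, 0 < delta i) -> relatively_weakly_open
  [set y : X | unit_ball X y /\
    forall i, (i < N)%N -> `|e i y - e i x| < delta i].
Proof.
move=> d0.
pose U i : set (weak_topology X) := e i @^-1` ball (e i x : K^o) (delta i).
have oU i : open (U i).
  by apply: open_comp; [move=> y _; exact: weak_continuous | exact: ball_open].
exists [set y | forall i, (i < N)%N -> U i y]; split.
  elim: N => [|N IHN].
    rewrite [X in open X](_ : _ = setT); first exact: openT.
    by apply/seteqP; split.
  rewrite [X in open X](_ : _ = [set y | forall i, (i < N)%N -> U i y] `&` U N).
    exact: openI.
  apply/seteqP; split => y /= H.
    by split=> [i iN|]; apply: H; rewrite // ltnW.
  by move=> i; rewrite ltnS leq_eqVlt => /orP[/eqP->|]; [exact: H.2|exact: H.1].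
apply/seteqP; split => y /= [H1 H2]; split => // i iN.
  by rewrite /U /= /ball /= distrC; exact: H2.
by have := H1 i iN; rewrite /U /= /ball /= distrC.
Qed.
End Combination.

(** * Isometric preduals of l1 *)

Section Predual.
Context (R : realType) (K : numFieldType) (re : K -> R)
  (iota : {rmorphism R -> K}) (rp : real_part re iota) (X : normedModType K).

Section Isometry.
Context (T : {linear dual X -> l1 K}) (e : nat -> dual X).
Hypotheses (T_iso : forall f, l1_norm re (T f) = dual_norm re f)
  (Te : forall i, T (e i) = l1_delta K i).

Implicit Types h : dual X.

Definition dual_head (h : dual X) N : dual X := \sum_(i < N) T h i *: e i.

Lemma dual_headE h N x : dual_head h N x = \sum_(i < N) T h i * e i x.
Proof. exact: (big_morph (fun f : dual X => f x) (id1 := 0) (op1 := +%R)). Qed.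

Lemma l1_tailE h N i :
  T (h - dual_head h N) i = if (i < N)%N then 0 else T h i.
Proof.
have headE : T (dual_head h N) i = \sum_(j < N) T h j * (i == j)%:R.
  rewrite linear_sum/=.
  rewrite (big_morph (fun a : l1 K => a i) (id1 := 0) (op1 := +%R))//.
  by apply: eq_bigr => j _; rewrite linearZ/= Te.
rewrite linearB -[LHS]/(T h i - T (dual_head h N) i) headE.
case: ltnP => iN; last first.
  rewrite big1 ?subr0// => j _.
  by rewrite gtn_eqF ?mulr0// (leq_trans (ltn_ord j)).
rewrite (bigD1 (Ordinal iN))//= eqxx mulr1 big1 ?addr0 ?subrr// => j.
by rewrite -val_eqE/= eq_sym => /negPf->; rewrite mulr0.
Qed.

(** The norm of l1 is additive over disjoint supports, and [T] carries this over to the dual. *)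
Lemma dual_norm_tail h N :
  dual_norm re (h - dual_head h N) = dual_norm re h - l1_head re (T h) N.
Proof. by rewrite -!T_iso; apply: (l1_norm_tail rp) => i; exact: l1_tailE. Qed.

Lemma dual_basis_le1 i y : unit_ball X y -> `|e i y| <= 1.
Proof.
move=> y1; rewrite -(ge0_le_re rp)//.
rewrite (le_trans (dual_norm_ub rp _ y1))// -T_iso Te (re_one rp).
exact: (l1_norm_delta_le1 rp).
Qed.

(* The left-hand side is the real part of h at the element of l_infinity
   obtained from y by adding d to its first N coordinates. *)
Lemma dual_norm_perturbed h N (y : X) (d : 'I_N -> K) : unit_ball X y ->
  (forall i : 'I_N, `|e i y + d i| <= 1) ->
  re (h y + \sum_(i < N) T h i * d i) <= dual_norm re h.
Proof.
move=> y1 yd.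
(* The tail of [h] is evaluated at [y] itself and the head at the perturbed coordinates; their two
   bounds add up to the norm of [h]. *)
have -> : h y + \sum_(i < N) T h i * d i =
    (h - dual_head h N) y + \sum_(i < N) T h i * (e i y + d i).
  rewrite -[X in _ = X + _]/(h y - dual_head h N y) dual_headE -addrA.
  congr (_ + _); rewrite addrC -sumrB.
  by apply: eq_bigr => i _; rewrite mulrDr addrAC subrr add0r.
rewrite (re_add rp) -[leRHS](subrK (l1_head re (T h) N)) -dual_norm_tail lerD//.
  by rewrite (le_trans (re_le_norm rp _))// (dual_norm_ub rp).
rewrite (re_sum rp); apply: ler_sum => i _.
rewrite (le_trans (re_le_norm rp _))// (le_re rp)// normrM.
by rewrite ler_piMr.
Qed.

(** The tail of [h] costs [eta] at [x] and again at [y]. The head costs a third [eta], as its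
    coefficients have total modulus at most 1. *)
Lemma dual_perturbation h N (x y : X) (d : 'I_N -> K) (eta : R) :
  unit_ball X x -> unit_ball X y -> dual_norm re h <= 1 -> 0 <= eta ->
  dual_norm re h - l1_head re (T h) N <= eta ->
  (forall i : 'I_N, `|e i y + d i - e i x| <= iota eta) ->
  re (h x) - 3 * eta <= re (h y + \sum_(i < N) T h i * d i).
Proof.
move=> x1 y1 h1 eta0; rewrite -dual_norm_tail; set g := h - _ => g_eta d_eta.
have hE z : h z = g z + \sum_(i < N) T h i * e i z.
  by rewrite -dual_headE -[g z]/(h z - dual_head h N z) subrK.
have gb z : unit_ball X z -> `|re (g z)| <= eta.
  move=> z1; apply: le_trans g_eta; rewrite ler_norml lerNl -(reN rp).
  apply/andP; split; rewrite (le_trans (re_le_norm rp _)) ?normrN//;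
    exact: (dual_norm_ub rp).
clearbody g.
have sb : re (\sum_(i < N) T h i * e i x) - eta <=
    re (\sum_(i < N) T h i * e i y + \sum_(i < N) T h i * d i).
  rewrite lerBlDr -lerBlDl -(reB rp) -big_split -sumrB/=.
  apply: (le_trans (re_le_norm rp _)).
  apply: (@le_trans _ _ (re (\sum_(i < N) `|T h i| * iota eta))).
    apply: (le_re rp); apply: (le_trans (ler_norm_sum _ _ _)).
    apply: ler_sum => i _; rewrite -mulrDr -mulrBr normrM ler_wpM2l//.
    by rewrite -opprB normrN.
  rewrite -mulr_suml mulrC (re_iotaM rp) ler_piMr// (re_sum rp).
  by apply: le_trans h1; rewrite -T_iso; exact: (l1_head_le rp).
have := gb x x1; have := gb y y1; rewrite !ler_norml => /andP[gy _] /andP[_ gx].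
rewrite !hE -addrA !(re_add rp); move: sb; rewrite !(re_add rp); lra.
Qed.

End Isometry.

Lemma predual_l1_P1bar : isometric_predual_l1 re X -> property_P1bar re X.
Proof.
move=> [T [[Tinv TK TinvK] T_iso]] C [n [lam [S [lam0 lam1 Sslice ->]]]].
move=> _ [x [xS ->]].
pose e i := Tinv (l1_delta K i).
have Te i : T (e i) = l1_delta K i by rewrite /e TinvK.
have /choice[f /choice[eps feps]] := Sslice.
have f1 k : dual_norm re (f k) <= 1 by have [] := feps k.
have SE k : S k = slice re (f k) (eps k) by have [] := feps k.
have x1 k : unit_ball X (x k) by have := xS k; rewrite SE => -[].
pose gap k := re (f k (x k)) - (dual_norm re (f k) - eps k).
have gap0 k : 0 < gap k by have := xS k; rewrite SE subr_gt0 => -[].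
(* Three [eta] pay for [dual_perturbation]; the fourth absorbs the error of
   [convex_combination_approx], so that the final points stay in the slices. *)
have [eta [eta0 eta_gap]] : exists eta, 0 < eta /\ forall k, 4 * eta < gap k.
  have : \forall eta \near 0^'+, forall k, eta < gap k / 4.
    by apply: filter_forall => k; apply: nbhs_right_lt; rewrite divr_gt0.
  move=> /(filterI (nbhs_right_gt 0))/filter_ex[eta [eta0 etag]].
  by exists eta; split => // k; have := etag k; lra.
have [N N_tail] : exists N, forall k,
    dual_norm re (f k) - l1_head re (T (f k)) N < eta.
  have : \forall N \near \oo, forall k,
      dual_norm re (f k) - l1_head re (T (f k)) N < eta.
    by apply: filter_forall => k; rewrite -T_iso; exact: (l1_tail_small rp).
  by move=> /filter_ex.
have theta0 : 0 < iota eta by rewrite -(rmorph0 iota) (lt_iota rp).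
have /choice[delta /all_and2[delta0 deltaP]] : forall i, exists delta,
    0 < delta /\ forall s, `|s| <= 1 ->
    `|s - \sum_k lam k * e i (x k)| < delta ->
    exists s' : 'I_n -> K, [/\ forall k, `|s' k| <= 1,
      forall k, `|s' k - e i (x k)| <= iota eta & \sum_k lam k * s' k = s].
  move=> i; have [delta delta0 deltaP] := disc_combination_open rp lam0 lam1
    (fun k => dual_basis_le1 T_iso Te i (x1 k)) theta0.
  by exists delta.
set x0 := \sum_k lam k *: x k.
have x0E i : e i x0 = \sum_k lam k * e i (x k).
  by rewrite linear_sum; apply: eq_bigr => k _; rewrite linearZ.
eexists; split.
- exact: (weak_nbhd e x0 N delta0).
- split=> [|i _]; last by rewrite subrr normr0.
  rewrite /unit_ball/= -lam1 (le_trans (ler_norm_sum _ _ _))//.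
  apply: ler_sum => k _; rewrite normrZ gtr0_norm//.
  by apply: ler_piMr; [exact: ltW | exact: x1].
move=> y [y1 yx0].
(* Each of the first [N] coordinates of [y] is split separately; [s i k] becomes the coordinate [i]
   of the bidual element [y_k]. *)
have /choice[s sP] (i : 'I_N) : exists s' : 'I_n -> K, [/\
    forall k, `|s' k| <= 1, forall k, `|s' k - e i (x k)| <= iota eta &
    \sum_k lam k * s' k = e i y].
  apply: deltaP; first exact: (dual_basis_le1 T_iso Te i y1).
  by rewrite -x0E; exact: yx0.
pose d k (i : 'I_N) := s i k - e i y.
have yd k (i : 'I_N) : e i y + d k i = s i k by rewrite addrC subrK.
have lam_d (i : 'I_N) : \sum_k lam k * d k i = 0.
  under eq_bigr do rewrite mulrBr.
  by rewrite sumrB -mulr_suml lam1 mul1r; have [_ _ ->] := sP i; rewrite subrr.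
pose c k := re (f k y + \sum_(i < N) T (f k) i * d k i).
have c_gt k : dual_norm re (f k) - eps k + eta < c k.
  have := @dual_perturbation T e T_iso Te (f k) N (x k) y (d k) eta (x1 k) y1
    (f1 k) (ltW eta0) (ltW (N_tail k)).
  have /[swap]/[apply] :
      forall i : 'I_N, `|e i y + d k i - e i (x k)| <= iota eta.
    by move=> i; rewrite yd; have [_ + _] := sP i.
  by have := eta_gap k; rewrite /gap -/(c k); lra.
move=> B /nbhs_ballP[r r0 rB].
have r0' : 0 < re r.
  by rewrite -(lt_iota rp) rmorph0 -(ge0_iota rp)// ltW.
(* [eta] keeps the points in their slices, and [re r] puts their combination in the ball around
   [y]. *)
pose del := Num.min eta (re r).
have del0 : 0 < del by rewrite lt_min eta0.
have [|z [z1 yz fz]] := convex_combination_approx rp (lam := lam) (f := f)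
    (c := c) (y := y) del0.
  move=> g a a0.
  pose h k : dual X := lam k *: g + iota (a k) *: f k.
  have hE k v : h k v = lam k * g v + iota (a k) * f k v by [].
  have ThE k i : T (h k) i = lam k * T g i + iota (a k) * T (f k) i.
    by rewrite linearD !linearZ.
  (* The middle term is the real part of the sum of the [h k] at [y_k]. The perturbations cancel in
     the [g] part by [lam_d], which leaves exactly the left-hand side. *)
  apply: (@le_trans _ _ (\sum_k re (h k y + \sum_(i < N) T (h k) i * d k i))).
    rewrite -(re_sum rp) le_eqVlt; apply/orP; left; apply/eqP.
    under [in RHS]eq_bigr => k _.
      rewrite hE (_ : \sum_(i < N) _ = \sum_(i < N) lam k * T g i * d k i +
          iota (a k) * \sum_(i < N) T (f k) i * d k i); last first.
        rewrite mulr_sumr -big_split/=; apply: eq_bigr => i _.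
        by rewrite ThE mulrDl mulrA.
      rewrite addrACA -mulrDr; over.
    rewrite !big_split/= exchange_big/= [X in _ + X + _]big1 => [|i _].
      rewrite -mulr_suml lam1 mul1r addr0 (re_add rp); congr (_ + _).
      by rewrite (re_sum rp); apply: eq_bigr => k _; rewrite (re_iotaM rp).
    by under eq_bigr do rewrite mulrAC mulrC; rewrite -mulr_sumr lam_d mulr0.
  apply: ler_sum => k _; apply: (dual_norm_perturbed T_iso Te) => // i.
  by rewrite yd; have [+ _ _] := sP i.
exists (\sum_k lam k *: z k); split.
  exists z; split => // k; rewrite SE; split => //.
  have := fz k; have := c_gt k; have : del <= eta by rewrite ge_min lexx.
  lra.
apply: rB; rewrite -ball_normE/= (mod_norm_iota rp).
rewrite (ge0_iota rp (ltW r0)) (lt_iota rp).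
by apply: (lt_le_trans yz); rewrite ge_min lexx orbT.
Qed.

End Predual.

(** * The real and complex instances *)

Lemma real_part_real (R : realType) : real_part (@idfun R) (@idfun R).
Proof.
split=> //.
- by move=> z; exact: ler_norm.
- move=> V u.
  have u_lin : linear (u : V -> R^o) by move=> a x y; exact: (linearP u).
  pose L := GRing.isLinear.Build R V R^o *:%R (u : V -> R^o) u_lin.
  by exists (HB.pack (u : V -> R^o) L : {linear V -> R^o}).
Qed.

Lemma real_part_complex (R : realType) :
  real_part (@complex.Re R) (@real_complex R).
Proof.
split=> //.
- by move=> [a b] [c d].
- by move=> a [b c] /=; rewrite mul0r subr0.
- move=> [a b]; rewrite normc_def /= (le_trans (ler_norm _))//.
  by rewrite -sqrtr_sqr ler_wsqrtr// lerDl sqr_ge0.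
- by move=> a a0; rewrite lecE /= eqxx.
- move=> [a b]; rewrite normc_def lecE/= eqxx/= => ab1 a1; move: ab1.
  rewrite a1 expr1n -[leRHS]sqrtr1 ler_sqrt// gerDl.
  rewrite real_exprn_even_le0//= => /eqP->.
  by [].
move=> V u.
(* The classical recovery of a complex-linear functional from its real part. *)
pose f (x : V) : R[i]^o := u x -i* u ('i *: x).
have uZ (a : R) (x : V) : u (a%:C *: x) = a * u x.
  by rewrite -[LHS]/(u (a *: (x : realified (real_complex R) V))) linearZ.
have uD (x y : V) : u (x + y) = u x + u y by exact: (linearD u).
have uN (x : V) : u (- x) = - u x by exact: (linearN u).
have f_lin : linear f.
  move=> [a b] x y; rewrite /f.
  have zE (z : V) : (a +i* b) *: z = a%:C *: z + b%:C *: ('i *: z).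
    by rewrite scalerA -scalerDl; congr (_ *: _); simpc.
  have izE (z : V) : 'i *: ((a +i* b) *: z) = a%:C *: ('i *: z) - b%:C *: z.
    by rewrite !scalerA -scaleNr -scalerDl; congr (_ *: _); simpc.
  rewrite scalerDr izE zE.
  rewrite !uD uN !uZ.
  apply/eqP; rewrite eq_complex /=; apply/andP; split; apply/eqP; ring.
pose L := GRing.isLinear.Build R[i] V R[i]^o *:%R f f_lin.
by exists (HB.pack f L : {linear V -> R[i]^o}).
Qed.

Unset Implicit Arguments.

Theorem corollary2p9 (R : realType) :
  (forall X : completeNormedModType R,
     isometric_predual_l1 (@idfun R) X -> property_P1bar (@idfun R) X) /\
  (forall X : completeNormedModType R[i],
     isometric_predual_l1 (@complex.Re R) X ->
     property_P1bar (@complex.Re R) X).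
Proof.
split=> X.
- exact: (predual_l1_P1bar (real_part_real R)).
- exact: (predual_l1_P1bar (real_part_complex R)).
Qed.
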